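(* For any $\varepsilon>0$ and any integer $d\geq 2$ there exist positive constants $c_1$ and $c_2$, depending only on $d$ and $\varepsilon$, such that for every prime $p$ the following holds. Let $f\in\mathbb{F}_p[X]$ be of degree $d$, let $u\in\mathbb{F}_p$, let $N$ be an integer, and let $\mathcal{G}$ be a subgroup of $\mathbb{F}_p^*$ with $$ N^{\varepsilon}<\#\mathcal{G}<\min\{N^{2-\varepsilon},\, p^{1-\varepsilon}\}. $$ If $2\leq N<\min\{d^{c_1\mathscr{P}_0},\, T_u\}$, then $$ \rho(N)<c_2\,\frac{1}{\log N}. $$
   Context: Let $p$ be a prime, $\mathbb{F}_p$ the field of $p$ elements and $f\in\mathbb{F}_p[X]$. For $u\in\mathbb{F}_p$ let $(u_n)_{n\ge0}$ be the sequence $u_0=u$, $u_{n+1}=f(u_n)$ for $n=0,1,2,\ldots$. The trajectory length $T_u$ is the smallest integer $t$ for which there is an integer $s$ with $0\leq s<t$ and $u_s=u_t$. For $v\in\mathbb{F}_p$, $\mathscr{P}_v$ is the period length of the sequence with starting point $v$: the minimal integer $m>0$ such that $u_n=u_{n+m}$ for all $n=0,1,\ldots$ (where $u_0=v$), with $\mathscr{P}_v=\infty$ if the sequence is not purely periodic (only eventually periodic). In particular $\mathscr{P}_0$ is this quantity for the starting point $v=0$; if $\mathscr{P}_0=\infty$ then $d^{c_1\mathscr{P}_0}=\infty$. Put $\mathcal{V}_u(N)=\{u_n:\ 0\leq n\leq N\}$. For a subgroup $\mathcal{G}\subseteq\mathbb{F}_p^*$, $$\rho(N)=\frac{\#(\mathcal{V}_u(N)\cap\mathcal{G})}{\#\mathcal{V}_u(N)}.$$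 *)

(* Defs.v *)
From mathcomp Require Import all_boot all_order all_algebra all_fingroup.
From mathcomp Require Import all_classical all_reals all_analysis.

Set Implicit Arguments.
Unset Strict Implicit.
Unset Printing Implicit Defensive.

Import Order.TTheory GRing.Theory Num.Theory.
Local Open Scope ring_scope.

Section FieldSequence.
Context {F : finFieldType} (f : {poly F}).

Definition seqF (u : F) (n : nat) : F := iter n (fun x => f.[x]) u.

Lemma seqF_repeat (u : F) :
  exists t : nat, [exists s : 'I_t, seqF u s == seqF u t].
Proof.
have ninj : ~~ injectiveb (fun i : 'I_(#|F|.+1) => seqF u i).
  apply/negP => /injectiveP /leq_card; by rewrite card_ord ltnn.
have [i [j [neq_ij eq_ij]]] : exists i : 'I_(#|F|.+1), exists j : 'I_(#|F|.+1),
    i != j /\ seqF u i = seqF u j.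
  by case/injectivePn: ninj => i [j ij e]; exists i, j.
have [lt_ij|lt_ji|/val_inj eqv] := ltngtP i j; last by rewrite eqv eqxx in neq_ij.
- by exists j; apply/existsP; exists (Ordinal lt_ij); apply/eqP.
- by exists i; apply/existsP; exists (Ordinal lt_ji); apply/eqP.
Qed.

Definition trajectory_length (u : F) : nat := ex_minn (seqF_repeat u).

Definition is_period (v : F) (m : nat) : Prop :=
  (0 < m)%N /\ forall n : nat, seqF v n = seqF v (n + m)%N.

(* [None] stands for an infinite period (the sequence is not purely
   periodic). *)
Definition period_length (v : F) : option nat :=
  match pselect (exists m : nat, `[< is_period v m >]) with
  | left ex => Some (ex_minn ex)
  | right _ => None
  end.

Definition orbit_set (u : F) (N : nat) : {set F} :=
  [set seqF u n | n : 'I_N.+1].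

Definition subgroup_set (G : {group {unit F}}) : {set F} :=
  [set FinRing.uval g | g in G].

End FieldSequence.

Definition rho (R : realType) (F : finFieldType) (f : {poly F}) (u : F)
    (G : {group {unit F}}) (N : nat) : R :=
  #|orbit_set f u N :&: subgroup_set G|%:R / #|orbit_set f u N|%:R.

Definition pow_period (R : realType) (d : nat) (c : R) (P : option nat) :
    \bar R :=
  match P with
  | Some m => (d%:R `^ (c * m%:R))%:E
  | None => +oo%E
  end.

(* Main.v *)
(* If too many u_n with n <= N lie in the subgroup, then many blocks of K ~ log N
   consecutive terms contain m of them, so there are distinct r_1, ..., r_m < K
   and many x = u_{jK} with f^(r_1)(x), ..., f^(r_m)(x) all in the subgroup.
   These iterates are pairwise coprime, because modulo f^(r) the iterate
   f^(k + r) is the constant f^(k)(0), which is nonzero when 0 < k < K since the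
   period of 0 is at least K. Stepanov's method bounds the number of such x
   by about t^(1/2 + 1/m) times a power of d^K, where t is the order of the
   subgroup: one builds a nonzero combination of the X^a prod_i h_i^(t b_i)
   (h_i = f^(r_i), 0 <= b_i < B) vanishing to order B^(m-1) at each x. That the
   combination is nonzero is a Wronskian argument in the style of
   Mason-Stothers, valid in characteristic p since all degrees are below p. For
   m > 16 / eps and K a small multiple of log N the bound is o(N / log N), as
   t < N^(2 - eps). *)
Require Import Defs.
From mathcomp Require Import all_boot all_order all_algebra all_fingroup.
From mathcomp Require Import all_classical all_reals all_analysis.
From mathcomp Require Import cyclic zify ring lra.

Set Implicit Arguments.
Unset Strict Implicit.
Unset Printing Implicit Defensive.

Import Order.TTheory GRing.Theory Num.Theory.
Local Open Scope ring_scope.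

(** * Wronskians in characteristic p *)

Section Wronskian.
Variables (F : fieldType) (p : nat).
Hypothesis pcharFp : (p \in [pchar F])%R.

Definition wronskian n (w : 'I_n -> {poly F}) : 'M[{poly F}]_n :=
  \matrix_(i, j) (w j)^`(i).

Lemma deriv_eq0_coef (q : {poly F}) k : q^`() = 0 -> ~~ (p %| k)%N -> q`_k = 0.
Proof.
case: k => [|k] q0; first by rewrite dvdn0.
rewrite (dvdn_pcharf pcharFp) => k0.
have := congr1 (fun s : {poly F} => s`_k) q0; rewrite coef_deriv coef0.
by rewrite -mulr_natr => /eqP; rewrite mulf_eq0 (negPf k0) orbF => /eqP.
Qed.

(* A relation over F(X) whose coefficients have proportional derivatives
   becomes, after multiplication by [c j0 ^+ p.-1], a relation over F[X^p]; for
   polynomials of degree less than p such a relation splits coefficientwise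
   into relations over F. *)
Lemma constant_relation n (w c : 'I_n -> {poly F}) (j0 : 'I_n) :
  (forall j, size (w j) <= p)%N ->
  \sum_j c j * w j = 0 -> c j0 != 0 ->
  (forall j, c j0 * (c j)^`() = (c j0)^`() * c j) ->
  exists2 a : 'I_n -> F, a j0 != 0 & \sum_j a j *: w j = 0.
Proof.
move=> sw cw0 cj0 dc; have p_pr := pcharf_prime pcharFp.
have p_gt1 := prime_gt1 p_pr.
have charP : (p \in [pchar {poly F}])%R by rewrite (rmorph_pchar polyC).
pose e j := c j0 ^+ p.-1 * c j.
have de j : (e j)^`() = 0.
  rewrite /e derivM deriv_exp.
  (* [p.-1] equals -1 in characteristic p, so by [dc] the two terms of the derivative cancel. *)
  have -> : forall x : {poly F}, x *+ p.-1 = - x.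
    move=> x; apply/eqP; rewrite -addr_eq0 -mulrSr prednK ?(ltnW p_gt1) //.
    by rewrite mulrn_pchar.
  have -> : c j0 ^+ p.-1 = c j0 ^+ p.-2 * c j0.
    by rewrite -exprSr prednK // -subn1 subn_gt0.
  rewrite -[_ * c j0 * _]mulrA dc /=; ring.
have e_n0 : e j0 != 0 by rewrite /e -exprSr expf_neq0.
have ew0 : \sum_j e j * w j = 0.
  by under eq_bigr do rewrite /e -mulrA; rewrite -big_distrr /= cw0 mulr0.
pose N := (size (e j0)).-1.
have eN : (e j0)`_N != 0 by rewrite -lead_coefE lead_coef_eq0.
have pN : (p %| N)%N by apply: contraNT eN => /(deriv_eq0_coef (de j0)) ->.
exists (fun j => (e j)`_N) => //; apply/polyP => k; rewrite coef0 coef_sum.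
under eq_bigr do rewrite coefZ.
have [kp|kp] := ltnP k p; last first.
  by rewrite big1 // => j _; rewrite [_`_k]nth_default ?mulr0 //
    (leq_trans (sw j)).
(* Compare coefficients of X^(N + k), k < p. The exponents in [e j] are multiples of p; one below N
   would need a coefficient of [w j] in degree at least p, so only N contributes. *)
have := congr1 (fun s : {poly F} => s`_(N + k)) ew0.
rewrite coef0 coef_sum; apply: etrans; apply: eq_bigr => j _; rewrite coefM.
have Nk : (N < (N + k).+1)%N by rewrite ltnS leq_addr.
rewrite (bigD1 (Ordinal Nk)) //= addKn big1 ?addr0 // => i iN.
have [/dvdnP[a ai]|pi] := boolP (p %| i)%N; last by rewrite deriv_eq0_coef
  ?mul0r.
case/dvdnP: pN => b bN; rewrite [(w j)`__]nth_default ?mulr0 //.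
apply: leq_trans (sw j) _; have := ltn_ord i.
have : i != N :> nat by apply: contra iN => /eqP iN; apply/eqP/val_inj.
rewrite ai bN; move: kp; clear; move=> kp ab lt.
have [ab1|ba1|ab1] := ltngtP a b; [nia | nia | by rewrite ab1 eqxx in ab].
Qed.

(** If the determinant vanished, the cofactors [c j] of the last row would annihilate every row.
    Differentiating, their derivatives annihilate all rows but the last. The minor [M] is nonzero by
    induction, so the two solutions are proportional and [constant_relation] contradicts
    independence. *)
Lemma wronskian_neq0 n (w : 'I_n -> {poly F}) :
  (forall j, size (w j) <= p)%N ->
  (forall a : 'I_n -> F, \sum_j a j *: w j = 0 -> forall j, a j = 0) ->
  \det (wronskian w) != 0.
Proof.
elim: n w => [|n IHn] w sw indep; first by rewrite det_mx00 oner_neq0.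
pose wd (j : 'I_n) := widen_ord (leqnSn n) j.
have liftE (j : 'I_n) : lift ord_max j = wd j.
  by apply: val_inj; exact: lift_max.
set A := wronskian w; pose M := wronskian (w \o wd).
have M0 : \det M != 0.
  apply: IHn => [j|a aw0 j]; first exact: sw.
  pose b j := if unlift ord_max j is Some i then a i else 0.
  have bwd i : b (wd i) = a i by rewrite /b -liftE liftK.
  rewrite -bwd; apply: indep; rewrite big_ord_recr /= {2}/b unlift_none scale0r
    addr0.
  by rewrite -[RHS]aw0; apply: eq_bigr => i _; rewrite bwd.
apply/negP => /eqP detA0.
pose c j := cofactor A ord_max j.
have rel (i : 'I_n.+1) : \sum_j (w j)^`(i) * c j = 0.
  have := congr1 (fun B : 'M[{poly F}]_n.+1 => B i ord_max) (mul_mx_adj A).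
  rewrite detA0 !mxE mul0rn => {2}<-.
  by apply: eq_bigr => j _; rewrite !mxE.
have cmax : c ord_max = \det M.
  rewrite /c /cofactor addnn -mul2n exprM sqrrN !expr1n mul1r; congr (\det _).
  by apply/matrixP => i j; rewrite !mxE !liftE.
have rel' (i : 'I_n) : \sum_j (w j)^`(i) * (c j)^`() = 0.
  have /= := congr1 (@deriv F) (rel (wd i)); rewrite deriv0 linear_sum /=.
  under eq_bigr do rewrite derivM.
  rewrite big_split /=; under eq_bigr do rewrite -derivnS.
  by rewrite [X in X + _](rel (lift ord0 i)) add0r.
(* Eliminating the last coordinate between the two solutions leaves a vector in the kernel of
   [M]. *)
pose v : 'cV_n := \col_j (c ord_max * (c (wd j))^`() - (c ord_max)^`() * c (wd
  j)).
have v0 : v = 0.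
  have Mv : M *m v = 0.
    apply/matrixP => i k; rewrite !mxE; under eq_bigr do rewrite !mxE /=.
    have := rel (wd i); have := rel' i; rewrite !big_ord_recr /= => e1 e2.
    move/eqP: e1; rewrite addr_eq0 => /eqP e1; move/eqP: e2;
      rewrite addr_eq0 => /eqP e2.
    transitivity (c ord_max * (\sum_(j < n) (w (wd j))^`(i) * (c (wd j))^`())
      - (c ord_max)^`() * (\sum_(j < n) (w (wd j))^`(i) * c (wd j))).
      by rewrite !big_distrr /= -sumrB; apply: eq_bigr => j _; ring.
    by rewrite e1 e2; ring.
  have : \det M *: v = 0 by rewrite -mul_scalar_mx -mul_adj_mx -mulmxA Mv
    mulmx0.
  move/matrixP => dv; apply/matrixP => j k; have := dv j k; rewrite !mxE.
  by move/eqP; rewrite mulf_eq0 (negPf M0) => /eqP.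
have cn0 : c ord_max != 0 by rewrite cmax.
have [||a an0 /indep/(_ ord_max) a0] := @constant_relation _ w c _ sw _ cn0.
- by rewrite -[RHS](rel ord0); apply: eq_bigr => j _; rewrite mulrC derivn0.
- move=> j; have [i|] := unliftP ord_max j => [|->]; last by rewrite mulrC.
  rewrite liftE => ->; apply/eqP; rewrite -subr_eq0.
  by have := congr1 (fun u : 'cV_n => u i 0) v0; rewrite !mxE => ->.
- by rewrite a0 eqxx in an0.
Qed.
End Wronskian.

(** * Derivatives of multiples of a fixed factor *)

Section Twist.
Variables (F : fieldType) (r : {poly F}).

(* When [r] clears the denominator of the logarithmic derivative of [g], the
   [l]-th derivative of [q * g] is [g / r ^+ l] times a polynomial whose size
   does not depend on [g]. *)
Definition twist (g : {poly F}) l (q : {poly F}) : {poly F} :=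
  (r ^+ l * (q * g)^`(l)) %/ g.

(** The division in [twist] is exact, by induction on [l]: if y = s g, then r y' = r s' g + s (r
    g'), and r g' is a multiple of g. *)
Lemma twistK g l q : g %| r * g^`() -> twist g l q * g = r ^+ l * (q * g)^`(l).
Proof.
move=> dg; apply: divpK; elim: l => [|l IHl].
  by rewrite expr0 mul1r derivn0 dvdp_mull.
have -> : r ^+ l.+1 * (q * g)^`(l.+1)
    = r * (r ^+ l * (q * g)^`(l))^`() - r^`() * (r ^+ l * (q * g)^`(l)) *+ l.
  rewrite derivM deriv_exp -derivnS; case: l {IHl} => [|l] /=.
    by rewrite !mulr0n mul0r add0r subr0 expr0 expr1 mul1r.
  rewrite mulrnAl mulrDr mulrnAr addrAC.
  suff -> : r * (r^`() * r ^+ l * (q * g)^`(l.+1)) = r^`() * (r ^+ l.+1 * (q *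
    g)^`(l.+1)).
    by rewrite subrr add0r exprS mulrA.
  by rewrite exprS; ring.
case/dvdpP: IHl => s ->; rewrite dvdp_sub //; last first.
  by rewrite -mulr_natr dvdp_mulr // mulrA dvdp_mull.
rewrite derivM mulrDr dvdp_add //; first by rewrite mulrA dvdp_mull.
by rewrite mulrCA dvdp_mull.
Qed.

(** Differentiation does not raise degrees, so only the [l] factors [r] add to the degree of [q];
    that of [g] cancels in the quotient. *)
Lemma size_twist e g l q : g != 0 -> (size r <= e.+1)%N ->
  (size (twist g l q) <= size q + l * e)%N.
Proof.
move=> g0 sr; rewrite size_divp // leq_subLR.
apply: leq_trans (size_polyMleq _ _) _.
have := size_poly_exp_leq r l; have := size_polyMleq q g.
have : (size ((q * g)^`(l))%R <= size (q * g)%R)%N.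
  elim: l => [|l IHl]; rewrite ?derivn0 // derivnS; apply: leq_trans IHl.
  have [->|n0] := eqVneq (q * g)^`(l) 0; first by rewrite deriv0.
  exact: ltnW (lt_size_deriv n0).
have : (size g > 0)%N by rewrite size_poly_gt0.
have : ((size r).-1 * l <= l * e)%N by rewrite mulnC leq_mul2l; apply/orP;
  right; lia.
move: ((size r).-1 * l)%N (l * e)%N (size (r ^+ l)%R) (size ((q * g)^`(l))%R)
  => a b c d.
move: (size (q * g)%R) (size q) (size g) => i j k; lia.
Qed.

(** Makes the vanishing conditions in Stepanov's method linear in the unknown coefficients. *)
Lemma twist_sum g l (I : finType) (x : I -> F) (q : I -> {poly F}) :
  g != 0 -> g %| r * g^`() ->
  twist g l (\sum_i x i *: q i) = \sum_i x i *: twist g l (q i).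
Proof.
move=> g0 dg; apply: (mulIf g0); rewrite twistK // !mulr_suml.
have -> : (\sum_i x i *: q i * g)^`(l) = \sum_i x i *: (q i * g)^`(l).
  elim/big_ind2 : _ => [|u v u' v' <- <-|i _]; first by rewrite linear0.
    by rewrite linearD.
  by rewrite -scalerAl linearZ.
by rewrite mulr_sumr; apply: eq_bigr => i _; rewrite -scalerAr -scalerAl twistK.
Qed.
End Twist.

Lemma size_det (F : fieldType) n c (M : 'M[{poly F}]_n) :
  (forall i j, size (M i j) <= c.+1)%N -> (size (\det M)%R <= (n * c).+1)%N.
Proof.
move=> sM; apply: leq_trans (size_sum _ _ _) _; apply/bigmax_leqP => s _.
rewrite -signr_odd; have -> : size ((-1) ^+ odd s * \prod_i M i (s i)) = size
  (\prod_i M i (s i)).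
  by case: (odd s); rewrite ?expr0 ?mul1r // expr1 mulN1r size_polyN.
apply: leq_trans (size_prod_leq _ _) _; rewrite leq_subLR cardE size_enum_ord.
have : (\sum_(i < n) size (M i (s i)) <= \sum_(i < n) c.+1)%N by exact: leq_sum.
by rewrite sum_nat_const card_ord mulnS addnS ltnS.
Qed.

(** * Order of vanishing of a sum of independent terms *)

Section Order.
Variables (F : fieldType) (p : nat).
Hypothesis pcharFp : (p \in [pchar F])%R.

Lemma dvdp_derivn (h q : {poly F}) t l : h ^+ t %| q -> h ^+ (t - l) %| q^`(l).
Proof.
elim: l => [|l IHl] hq; first by rewrite subn0 derivn0.
rewrite derivnS subnS; case/dvdpP: (IHl hq) => s ->.
case: (t - l)%N => [|m] /=; first by rewrite dvd1p.
rewrite derivM dvdp_add // ?deriv_exp.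
  by rewrite exprS mulrA dvdp_mulIr.
by rewrite dvdp_mull // -mulr_natr dvdp_mulr // dvdp_mulIr.
Qed.

(** Scaling row [i] of the Wronskian by r^i gives a determinant of twists times the product of the
    [g j]. A high power of [h] divides the Wronskian, hence by coprimality the determinant of
    twists, whose degree does not involve the [g j]. *)
Lemma dvdp_sum_order n (q g : 'I_n -> {poly F}) (h r : {poly F}) t A e :
  (0 < n)%N -> (forall j, size (q j) <= A.+1)%N ->
  (forall j, size (q j * g j)%R <= p)%N ->
  (forall j, g j != 0) -> (forall j, g j %| r * (g j)^`()) ->
  (forall j, coprimep h (g j)) -> (1 < size h)%N ->
  r != 0 -> (size r <= e.+1)%N ->
  (forall a : 'I_n -> F, \sum_j a j *: (q j * g j) = 0 -> forall j, a j = 0) ->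
  h ^+ t %| \sum_j q j * g j ->
  (t <= n + n * (A + n * e))%N.
Proof.
move=> n_gt0 sq sqg g0 dg hg sh r0 sr indep ht.
pose w j := q j * g j; have W0 := wronskian_neq0 pcharFp sqg indep.
set W := wronskian _ in W0.
pose P : 'M[{poly F}]_n := \matrix_(i, j) twist r (g j) i (q j).
have detE : (\prod_(i < n) r ^+ i) * \det W = \det P * \prod_j g j.
  have <- : \det (diag_mx (\row_j g j)) = \prod_j g j.
    by rewrite det_diag; apply: eq_bigr => j _; rewrite mxE.
  have <- : \det (diag_mx (\row_(i < n) r ^+ i)) = \prod_(i < n) r ^+ i.
    by rewrite det_diag; apply: eq_bigr => j _; rewrite mxE.
  rewrite -!det_mulmx; congr (\det _); apply/matrixP => i j.
  by rewrite mul_diag_mx mul_mx_diag !mxE twistK.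
have P0 : \det P != 0.
  apply: contraNneq W0 => P0; move/eqP: detE; rewrite P0 mul0r mulf_eq0.
  by case/orP => // /prodf_eq0[i _]; rewrite expf_eq0 (negPf r0) andbF.
(* The columns of [W] add up to the derivatives of the sum, which have order below n and so lose
   fewer than n factors [h]; the adjugate carries this to the determinant. *)
have hW : h ^+ (t - n) %| \det W.
  have : \det W *: (const_mx 1 : 'cV_n) = \adj W *m (W *m const_mx 1).
    by rewrite mulmxA mul_adj_mx mul_scalar_mx.
  move/matrixP/(_ (Ordinal n_gt0) 0); rewrite !mxE mulr1 => ->.
  apply: (big_ind (fun s => _ %| s)) => [|? ?|i _];
    [exact: dvdp0|exact: dvdp_add|].
  rewrite dvdp_mull // mxE.
  have -> : \sum_j W i j * (const_mx 1 : 'cV_n) j 0 = (\sum_j w j)^`(i).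
    by rewrite linear_sum; apply: eq_bigr => j _; rewrite !mxE mulr1.
  apply: dvdp_trans (dvdp_derivn i ht); apply: dvdp_exp2l.
  by apply: leq_sub2l; exact: ltnW.
have : h ^+ (t - n) %| \det P.
  have := dvdp_mull (\prod_(i < n) r ^+ i) hW; rewrite detE Gauss_dvdpl //.
  apply: coprimep_expl; apply: (big_ind (fun s => coprimep h s)) => // [|x y].
    exact: coprimep1.
  by rewrite coprimepMr => -> ->.
move/(dvdp_leq P0) => le.
have sP : (size (\det P)%R <= (n * (A + n * e)).+1)%N.
  apply: size_det => i j; rewrite mxE; apply: leq_trans (size_twist _ _ (g0 j)
    sr) _.
  by rewrite -addSn leq_add // leq_mul2r (ltnW (ltn_ord i)) orbT.
have sE := size_exp h (t - n).
have : (t - n <= (size h).-1 * (t - n))%N by apply: leq_pmull;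
  case: size sh => [|[]].
rewrite -sE; clear sE; move: (n * (A + n * e))%N le sP => x.
move: (size (h ^+ _)%R) (size (\det P)%R) => a b; clear; lia.
Qed.
End Order.

(** * Independence of products of powers *)

Section PowerProducts.
Variables (F : fieldType) (m : nat) (h : 'I_m -> {poly F}).

Definition power_prod (e : 'I_m -> nat) : {poly F} := \prod_i h i ^+ e i.

Lemma power_prod_neq0 e : (forall i, h i != 0) -> power_prod e != 0.
Proof. by move=> h0; apply/prodf_neq0 => i _; rewrite expf_neq0. Qed.

Lemma coprimep_power_prod q e : (forall i, (0 < e i)%N -> coprimep q (h i)) ->
  coprimep q (power_prod e).
Proof.
move=> hq; apply: (big_ind (coprimep q)) => [|x y|i _]; first exact: coprimep1.
  by rewrite coprimepMr => -> ->.
case: (e i) (hq i) => [_|k hk]; first by rewrite expr0 coprimep1.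
exact/coprimep_expr/hk.
Qed.

(** The logarithmic derivative is the sum of the e_i h_i' / h_i, so the product of the [h i] clears
    its denominator. *)
Lemma dvdp_power_prod_deriv e :
  power_prod e %| (\prod_i h i) * (power_prod e)^`().
Proof.
rewrite /power_prod; elim/big_ind2: _ => [|g1 r1 g2 r2 d1 d2|i _].
- exact: dvd1p.
- by rewrite derivM mulrDr; apply: dvdp_add; rewrite mulrACA dvdp_mul //
  dvdp_mull.
- rewrite deriv_exp; case: (e i) => [|k] /=; first by rewrite dvd1p.
  by rewrite -mulr_natr -mulrA exprS dvdp_mul // mulrCA dvdp_mulIl.
Qed.

Lemma size_power_prod D e : (forall i, size (h i) <= D.+1)%N ->
  (size (power_prod e) <= (\sum_i D * e i).+1)%N.
Proof.
move=> sh; rewrite /power_prod; elim/big_ind2: _ => [|g1 k1 g2 k2 s1 s2|i _].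
- by rewrite size_poly1.
- by apply: leq_trans (size_polyMleq _ _) _; lia.
- apply: leq_trans (size_poly_exp_leq _ _) _; rewrite ltnS leq_mul2r.
  by have := sh i; lia.
Qed.

End PowerProducts.

Section Independence.
Variables (F : fieldType) (p : nat).
Hypothesis pcharFp : (p \in [pchar F])%R.
Variables (m B D A t : nat) (h : 'I_m -> {poly F}).
Hypothesis h_coprime : forall i j, i != j -> coprimep (h i) (h j).
Hypothesis size_h : forall i, (1 < size (h i) <= D.+1)%N.
Hypothesis small : (A + m * (D * (t * B)) <= p)%N.
Hypothesis large : (B ^ m + B ^ m * (A + B ^ m * (m * D)) < t)%N.

Local Notation g b := (power_prod h (fun i => t * (b : {ffun 'I_m ->
  'I_B}) i)%N).

(* In a relation with minimal support the terms in which [h i0] has the lowest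
   exponent are independent over F, yet, once the common power of [h i0] is
   removed, their sum is divisible by [h i0 ^+ t]. *)
Lemma power_prod_independent (q : {ffun 'I_m -> 'I_B} -> {poly F}) :
  (forall b, size (q b) <= A)%N -> \sum_b q b * g b = 0 -> forall b, q b = 0.
Proof.
have h0 i : h i != 0 by rewrite -size_poly_gt0; case/andP: (size_h i) => /ltnW.
have hD i : (size (h i) <= D.+1)%N by case/andP: (size_h i).
pose supp (q : {ffun 'I_m -> 'I_B} -> {poly F}) := [set b | q b != 0].
have [n] := ubnP #|supp q|; elim: n q => // n IHn q leqn sq rel.
have [S0|[b1 b1S]] := set_0Vmem (supp q).
  by move=> b; have : b \notin supp q; [rewrite S0 inE | rewrite inE negbK =>
    /eqP].
have g0 (b : {ffun 'I_m -> 'I_B}) : g b != 0 by exact: power_prod_neq0.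
have relS : \sum_(b in supp q) q b * g b = 0.
  rewrite -[RHS]rel [RHS](bigID (mem (supp q))) /= [X in _ + X]big1 ?addr0 //.
  by move=> b; rewrite inE negbK => /eqP->; rewrite mul0r.
(* A single nonzero term cannot vanish, so the support has a second element. *)
have [b2 b2S b12] : exists2 b2, b2 \in supp q & b2 != b1.
  apply/exists_inP; apply/contraT; rewrite negb_exists_in => /forall_inP only.
  move: relS; rewrite (big_pred1 b1) => [/eqP|b]; last first.
    by apply/idP/eqP => [/only|->//]; rewrite negbK => /eqP.
  by rewrite mulf_eq0 (negPf (g0 b1)) orbF; move: b1S; rewrite inE => /negPf->.
have [i0 b12i] : exists i0, b2 i0 != b1 i0.
  apply/existsP; apply: contraT; rewrite negb_exists => /forallP eqb.
  by case/eqP: b12; apply/ffunP => i; apply/eqP; rewrite -[_ == _]negbK.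
case: (arg_minnP (fun b : {ffun 'I_m -> 'I_B} => b i0 : nat) b1S) =>
  bm bmS' bmin.
have bmS : bm \in supp q by [].
(* [T] misses [b1] or [b2], so the induction hypothesis covers every relation supported on it. *)
pose T := [set b in supp q | b i0 == bm i0].
have inT b : (b \in T) = (b \in supp q) && (b i0 == bm i0) by rewrite
  finset.in_set.
have bmT : bm \in T by rewrite inT bmS eqxx.
have ltT : (#|T| < #|supp q|)%N.
  apply: proper_card; rewrite properE; apply/andP; split.
    by apply/fintype.subsetP => b; rewrite inT => /andP[].
  apply: contra b12i => /fintype.subsetP sub.
  by move: (sub _ b1S) (sub _ b2S); rewrite !inT =>
    /andP[_ /eqP->] /andP[_ /eqP->].
pose e (b : {ffun 'I_m -> 'I_B}) i := if i == i0 then 0%N else (t * b i)%N.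
have gE (b : {ffun 'I_m -> 'I_B}) : g b = h i0 ^+ (t * b i0) * power_prod h (e
  b).
  rewrite /power_prod [LHS](bigD1 i0) //= [in RHS](bigD1 i0) //= {1}/e eqxx.
  rewrite expr0 mul1r; congr (_ * _); apply: eq_bigr => i ii0.
  by rewrite /e (negPf ii0).
pose v := (t * bm i0)%N.
have gT b : b \in T -> g b = h i0 ^+ v * power_prod h (e b).
  by rewrite inT gE => /andP[_ /eqP->].
(* The sum over [T] is minus the sum of the other terms, whose exponent at [i0] is at least
   [bm i0 + 1]. *)
have dvdT : h i0 ^+ t %| \sum_(b in T) q b * power_prod h (e b).
  rewrite -(@dvdp_mul2l _ (h i0 ^+ v)) ?expf_neq0 // big_distrr /=.
  have -> : \sum_(b in T) h i0 ^+ v * (q b * power_prod h (e b))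
      = - \sum_(b in supp q | b \notin T) q b * g b.
    apply/eqP; rewrite -addr_eq0 -[X in _ == X]relS [X in _ == X](bigID (mem
      T)) /=.
    apply/eqP; congr (_ + _); apply: eq_big => [b|b bT].
      by rewrite inT; case: (b \in supp q).
    by rewrite gT // mulrCA.
  rewrite -mulN1r dvdp_mull //.
  apply: (big_ind (fun s => _ %| s)) => [|? ?|b /andP[bS bT]].
  - exact: dvdp0.
  - exact: dvdp_add.
  rewrite gE mulrCA dvdp_mulr // -exprD; apply: dvdp_exp2l.
  rewrite addnC -mulnS leq_mul2l orbC ltn_neqAle bmin // andbT.
  by apply/orP; left; apply: contra bT; rewrite inT bS eq_sym.
have indep (a : 'I_#|T| -> F) :
    \sum_j a j *: (q (enum_val j) * power_prod h (e (enum_val j))) = 0 ->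
      forall j, a j = 0.
  move=> rela j.
  pose q' b := if b \in T then a (enum_rank_in bmT b) *: q b else 0.
  have q'0 : forall b, q' b = 0.
    apply: IHn => [|b|].
    - apply: (@leq_ltn_trans #|T|); last exact: leq_trans ltT leqn.
      apply/subset_leq_card/fintype.subsetP => b; rewrite inE /q'.
      by case: (b \in T) => //; rewrite eqxx.
    - rewrite /q'; case: ifP => _; last by rewrite size_poly0.
      exact: leq_trans (size_scale_leq _ _) (sq b).
    - rewrite (bigID (mem T)) /= [X in _ + X]big1 ?addr0; last first.
        by move=> b /negPf bT; rewrite /q' bT mul0r.
      rewrite -[RHS](mulr0 (h i0 ^+ v)) -[in RHS]rela big_enum_val big_distrr
        /=.
      apply: eq_bigr => k _; rewrite /q' enum_valP gT ?enum_valP //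
        enum_valK_in.
      by rewrite -!scalerAl -scalerAr mulrCA.
  have := q'0 (enum_val j); rewrite /q' enum_valP enum_valK_in => /eqP.
  have : enum_val j \in supp q by have := enum_valP j; rewrite inT => /andP[].
  by rewrite inE -!size_poly_eq0 => qn0; have [//|an0] := eqVneq (a j) 0;
    rewrite size_scale // (negPf qn0).
have T_gt0 : (0 < #|T|)%N by apply/card_gt0P; exists bm.
have TB : (#|T| <= B ^ m)%N.
  by apply: leq_trans (max_card _) _; rewrite card_ffun !card_ord.
have sr : (size (\prod_i h i)%R <= (m * D).+1)%N.
  have := size_power_prod (fun=> 1%N) hD.
  by rewrite /power_prod; under eq_bigr do rewrite expr1;
    rewrite sum_nat_const card_ord muln1.
(* The bound of [dvdp_sum_order] for at most B^m terms contradicts [large]; [small] keeps the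
   degrees below p, as the Wronskian criterion requires. *)
suff tle : (t <= #|T| + #|T| * (A + #|T| * (m * D)))%N.
  have := leq_trans large tle; rewrite ltnNge => /negP[].
  by rewrite leq_add ?leq_mul // leq_add2l leq_mul.
apply: (@dvdp_sum_order F p pcharFp #|T| (fun j => q (enum_val j))
  (fun j => power_prod h (e (enum_val j))) (h i0) (\prod_i h i) t A (m * D)%N)
    => //.
- by move=> j; apply: leqW.
- move=> j; apply: leq_trans small; apply: leq_trans (size_polyMleq _ _) _.
  have : (size (power_prod h (e (enum_val j))) <= (m * (D * (t * B))).+1)%N.
    apply: leq_trans (size_power_prod _ hD) _; rewrite ltnS.
    rewrite -[X in (_ <= X * _)%N](card_ord m) -sum_nat_const;
      apply: leq_sum => i _.
    rewrite leq_mul2l /e; case: ifP => _; rewrite ?orbT // leq_mul2l.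
    by rewrite (ltnW (ltn_ord _)) !orbT.
  have := sq (enum_val j); lia.
- by move=> j; exact: power_prod_neq0.
- by move=> j; exact: dvdp_power_prod_deriv.
- move=> j; apply: coprimep_power_prod => i; rewrite /e.
  by case: eqP => // /eqP ii0 _; apply: h_coprime; rewrite eq_sym.
- by case/andP: (size_h i0).
- by apply/prodf_neq0 => i _.
- by move: dvdT; rewrite big_enum_val.
Qed.
End Independence.

(** * Stepanov's method *)

Lemma underdetermined_system (F : fieldType) (U V : finType) (c : U -> V -> F) :
  (#|V| < #|U|)%N ->
  exists x : U -> F, (exists u, x u != 0) /\ forall v, \sum_u x u * c u v = 0.
Proof.
move=> VU; pose M := \matrix_(i < #|U|, j < #|V|) c (enum_val i) (enum_val j).
have : kermx M != 0.
  rewrite kermx_eq0 /row_free; apply: contraTneq VU => <-.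
  by rewrite -leqNgt rank_leq_col.
case/rowV0Pn => v /sub_kermxP vM v0.
exists (fun u => v 0 (enum_rank u)); split.
  by have [i vi] := rV0Pn _ v0; exists (enum_val i); rewrite enum_valK.
move=> w; have := congr1 (fun B : 'rV_#|V| => B 0 (enum_rank w)) vM.
rewrite !mxE; apply: etrans.
rewrite (reindex (@enum_val U predT)) /=; last exact/onW_bij/enum_val_bij.
by apply: eq_bigr => i _; rewrite mxE enum_valK enum_rankK.
Qed.

Section Multiplicity.
Variables (F : fieldType).

(** When one more factor is split off, the derivative brings in the current multiplicity as a
    coefficient; it is below p, hence invertible. *)
Lemma dvdp_exp_XsubC_derivn p (pcharFp : (p \in [pchar F])%R) (q : {poly F}) x
  L :
  (L <= p)%N -> (forall l, (l < L)%N -> root q^`(l) x) -> ('X - x%:P) ^+ L %| q.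
Proof.
elim: L q => [|L IHL] q Lp rq; first by rewrite dvd1p.
have /dvdpP[s qE] : ('X - x%:P) ^+ L %| q.
  by apply: IHL => [|l lL]; [exact: ltnW | apply: rq; exact: ltnW].
have : ('X - x%:P) ^+ L %| q^`().
  by apply: IHL => [|l lL]; [exact: ltnW | rewrite -derivSn; apply: rq].
rewrite qE exprS dvdp_mul2r ?expf_neq0 ?polyXsubC_eq0 // dvdp_XsubCl.
case: L {IHL} Lp rq qE => [|L] Lp rq qE.
  by move=> _; have := rq 0%N isT; rewrite derivn0 qE expr0 mulr1.
rewrite derivM deriv_exp derivXsubC mul1r /= dvdp_addr ?dvdp_mulIr //.
rewrite exprS -mulr_natl mulrCA mulrA dvdp_mul2r ?expf_neq0 ?polyXsubC_eq0 //.
rewrite dvdp_XsubCl -polyC_natr rootM rootC => /orP[|//].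
rewrite -(dvdn_pcharf pcharFp) => /(dvdn_leq (isT : 0 < L.+1)%N).
by move/(leq_trans Lp); rewrite ltnn.
Qed.

Lemma size_roots_multiplicity (q : {poly F}) (s : seq F) L : q != 0 -> uniq s ->
  {in s, forall x, ('X - x%:P) ^+ L %| q} -> (size s * L < size q)%N.
Proof.
move=> q0 us dq; have : (\prod_(x <- s) ('X - x%:P)) ^+ L %| q.
  elim: s us dq => [|x s IHs] /=; first by rewrite big_nil expr1n dvd1p.
  case/andP=> xs us dq; rewrite big_cons exprMn Gauss_dvdp.
    by rewrite dq ?mem_head // IHs // => y ys; apply: dq; rewrite inE ys orbT.
  apply/coprimep_expl/coprimep_expr; rewrite coprimep_sym coprimep_XsubC
    root_prod_XsubC.
  by rewrite (negPf xs).
move/(dvdp_leq q0); apply: leq_trans.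
have := size_exp (\prod_(x <- s) ('X - x%:P)) L.
rewrite size_prod_XsubC /= => <-; rewrite prednK // size_poly_gt0 expf_neq0 //.
by rewrite -size_poly_gt0 size_prod_XsubC.
Qed.
End Multiplicity.

Section Stepanov.
Variables (F : fieldType) (p : nat).
Hypothesis pcharFp : (p \in [pchar F])%R.
Variables (m B D t : nat) (h : 'I_m -> {poly F}).
Hypothesis m_gt0 : (0 < m)%N.
Hypothesis B_gt2 : (2 < B)%N.
Hypothesis h_coprime : forall i j, i != j -> coprimep (h i) (h j).
Hypothesis size_h : forall i, (1 < size (h i) <= D.+1)%N.
Hypothesis small : (2 * (m * (D * (t * B))) <= p)%N.
Hypothesis large : (4 * (m * D) * B ^ (2 * m) <= t)%N.

Local Notation g b := (power_prod h (fun i => t * (b : {ffun 'I_m ->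
  'I_B}) i)%N).

(** The auxiliary polynomial is the sum of the [q b * g b]. Each [g b] is 1 on [s], so there r^l
    times its l-th derivative equals a sum of twists, which the choice of coefficients makes zero
    for l < L. Comparing [size s * L] with the degree gives the bound. *)
Lemma stepanov_bound (s : seq F) : uniq s ->
  {in s, forall x, forall i, (h i).[x] ^+ t = 1} ->
  (size s * B ^ m.-1 <= B ^ m.-1 * (m * D) + m * (D * (t * B)))%N.
Proof.
(* [L] is the order of vanishing. [A = L * e] matches the degree allowed to the [q b] with the
   growth of their twists. *)
move=> us hs; set e := (m * D)%N; set L := (B ^ m.-1)%N; pose A := (L * e)%N.
have hD i : (size (h i) <= D.+1)%N by case/andP: (size_h i).
have h0 i : h i != 0 by rewrite -size_poly_gt0; case/andP: (size_h i) => /ltnW.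
have g0 (b : {ffun 'I_m -> 'I_B}) : g b != 0 by exact: power_prod_neq0.
have D_gt0 : (0 < D)%N.
  by have := size_h (Ordinal m_gt0); case: (D) => // /andP[a b];
    have := leq_trans a b.
have e_gt0 : (0 < e)%N by rewrite muln_gt0 m_gt0.
have BmE : (B ^ m = B * L)%N by rewrite -expnS prednK.
have L_gt0 : (0 < L)%N by rewrite expn_gt0; case: (B) B_gt2.
have B2mE : (B ^ (2 * m) = (B * L) * (B * L))%N by rewrite mul2n -addnn expnD
  BmE.
have A_t : (A <= t)%N by apply: leq_trans large; rewrite /A B2mE; nia.
have L_t : (L <= t)%N by apply: leq_trans A_t; rewrite leq_pmulr.
have small' : (A + m * (D * (t * B)) <= p)%N.
  apply: leq_trans small; rewrite mul2n -addnn leq_add2r.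
  apply: leq_trans A_t _; rewrite mulnA; apply: leq_trans (leq_pmull _ e_gt0).
  by rewrite leq_pmulr // (ltn_trans _ B_gt2).
have large' : (B ^ m + B ^ m * (A + B ^ m * (m * D)) < t)%N.
  apply: leq_trans large; rewrite B2mE BmE /A -/e; nia.
have Lp : (L <= p)%N.
  by apply: leq_trans small'; apply: leq_trans (leq_addr _ _);
    rewrite leq_pmulr.
set r := \prod_i h i.
have dg (b : {ffun 'I_m -> 'I_B}) : g b %| r * (g b)^`() by exact:
  dvdp_power_prod_deriv.
have sr : (size r <= e.+1)%N.
  have := size_power_prod (fun=> 1%N) hD.
  by rewrite /power_prod; under eq_bigr do rewrite expr1;
    rewrite sum_nat_const card_ord muln1.
pose U := ('I_A * {ffun 'I_m -> 'I_B})%type; pose V :=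
  ('I_L * 'I_(A + L * e))%type.
(* There are A B L unknowns and L (A + L e) = 2 A L equations, and B > 2. *)
have cardUV : (#|{: V}| < #|{: U}|)%N.
  by rewrite !card_prod card_ffun !card_ord BmE /A; nia.
have [x [[[a0 b0] xn0] xrel]] := underdetermined_system
  (fun (u : U) (v : V) => (twist r (g u.2) v.1 'X^(u.1))`_(v.2)) cardUV.
pose q (b : {ffun 'I_m -> 'I_B}) : {poly F} := \sum_(a < A) x (a, b) *: 'X^a.
have sq b : (size (q b) <= A)%N.
  apply: leq_trans (size_sum _ _ _) _; apply/bigmax_leqP => a _.
  by apply: leq_trans (size_scale_leq _ _) _; rewrite size_polyXn.
pose P := \sum_b q b * g b.
have P0 : P != 0.
  apply: contra_neq xn0 => P0.
  have := power_prod_independent pcharFp h_coprime size_h small' large' sq P0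
    b0.
  move=> /(congr1 (fun s : {poly F} => s`_a0)); rewrite coef0 coef_sum => <-.
  rewrite (bigD1 a0) //= coefZ coefXn eqxx mulr1 big1 ?addr0 // => a aa0.
  by rewrite coefZ coefXn eq_sym (negPf aa0 : (a == a0 :> nat) = false) mulr0.
have rel l : (l < L)%N -> \sum_b twist r (g b) l (q b) = 0.
  move=> lL; apply/polyP => k; rewrite coef0 coef_sum.
  have [kA|kA] := ltnP k (A + L * e); last first.
    rewrite big1 // => b _; apply: nth_default; apply: leq_trans kA.
    apply: leq_trans (size_twist _ _ (g0 b) sr) _.
    by rewrite leq_add ?sq // leq_mul2r (ltnW lL) orbT.
  rewrite -[RHS](xrel (Ordinal lL, Ordinal kA)) /=.
  transitivity (\sum_b \sum_(a < A) x (a, b) * (twist r (g b) l 'X^a)`_k).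
    by apply: eq_bigr => b _; rewrite twist_sum // coef_sum;
      apply: eq_bigr => a _; rewrite coefZ.
  by rewrite exchange_big pair_bigA /=; apply: eq_bigr => -[].
have : (size s * L < size P)%N.
  apply: size_roots_multiplicity => // y ys; apply: (dvdp_exp_XsubC_derivn
    pcharFp Lp) => l lL.
  (* Needed to cancel r^l at [y]; a zero of some [h i] could not satisfy [hs], as t > 0. *)
  have ry : r.[y] != 0.
    rewrite horner_prod; apply/prodf_neq0 => i _; apply: contraTneq isT => hy.
    have := hs y ys i; rewrite hy expr0n => /eqP;
      case: (t) (leq_trans L_gt0 L_t) => //= ? _.
    by rewrite eq_sym oner_eq0.
  have : r ^+ l * P^`(l) = \sum_b twist r (g b) l (q b) * g b.
    rewrite linear_sum mulr_sumr; apply: eq_bigr => b _; rewrite twistK //.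
  move/(congr1 (fun s => s.[y])); rewrite hornerM horner_exp horner_sum.
  have -> : \sum_b (twist r (g b) l (q b) * g b).[y] = (\sum_b twist r (g b) l
    (q b)).[y].
    rewrite horner_sum; apply: eq_bigr => b _; rewrite hornerM.
    have -> : (g b).[y] = 1; last by rewrite mulr1.
    by rewrite horner_prod; apply: big1 => i _;
      rewrite horner_exp exprM hs // expr1n.
  rewrite rel // horner0 => /eqP; rewrite mulf_eq0 expf_eq0 (negPf ry) andbF /=.
  by rewrite rootE.
move=> sL; apply: ltnW; apply: leq_trans sL _.
apply: leq_trans (size_sum _ _ _) _; apply/bigmax_leqP => b _.
apply: leq_trans (size_polyMleq _ _) _.
have : (size (g b) <= (m * (D * (t * B))).+1)%N.
  apply: leq_trans (size_power_prod _ hD) _; rewrite ltnS.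
  rewrite -[X in (_ <= X * _)%N](card_ord m) -sum_nat_const;
    apply: leq_sum => i _.
  by rewrite leq_mul2l leq_mul2l (ltnW (ltn_ord _)) !orbT.
by have := sq b; rewrite /A; lia.
Qed.
End Stepanov.

(** * Orbits *)

Section Iterates.
Variables (F : finFieldType) (f : {poly F}).

Definition iter_poly n : {poly F} := iter n (fun q => f \Po q) 'X.

Lemma horner_iter_poly n x : (iter_poly n).[x] = seqF f x n.
Proof. by elim: n => [|n IHn] /=; rewrite ?hornerX // horner_comp IHn. Qed.

Lemma size_iter_poly d n : size f = d.+1 -> (0 < d)%N ->
  size (iter_poly n) = (d ^ n).+1.
Proof.
move=> sf d_gt0; elim: n => [|n IHn] /=; first by rewrite size_polyX.
have : (size (f \Po iter_poly n)).-1 = (d ^ n.+1)%N.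
  by rewrite size_comp_poly sf IHn -expnS.
case: (size _) => [/esym/eqP|s /= -> //].
by rewrite expn_eq0; case: d d_gt0 {sf IHn}.
Qed.

Lemma iter_polyD m n : iter_poly (m + n) = iter_poly m \Po iter_poly n.
Proof. by elim: m => [|m IHm] /=; rewrite ?comp_polyX // IHm comp_polyA. Qed.

(* Modulo [f^(n)], the iterate [f^(k + n)] is the constant [f^(k) 0]. *)
Lemma coprimep_iter_poly k n : seqF f 0 k != 0 ->
  coprimep (iter_poly n) (iter_poly (k + n)).
Proof.
rewrite -horner_iter_poly iter_polyD => c0; set c := _.[_] in c0.
have /factor_theorem[w wE] : root (iter_poly k - c%:P) 0.
  by rewrite /root hornerD hornerN hornerC subrr.
have -> : iter_poly k = w * 'X + c%:P.
  by apply/eqP; rewrite -subr_eq wE subr0.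
rewrite comp_polyD comp_polyM comp_polyX comp_polyC coprimep_addl_mul.
by rewrite -[c%:P]mulr1 mul_polyC coprimepZr // coprimep1.
Qed.

Lemma seqFD u m n : seqF f u (m + n) = seqF f (seqF f u n) m.
Proof. exact: iterD. Qed.

End Iterates.

Lemma card_set_sum (I : finType) (P : pred I) : (#|[set x | P x]| = \sum_x P
  x)%N.
Proof.
rewrite cardsE -sum1_card big_mkcond; apply: eq_bigr => x _.
by rewrite unfold_in; case: (P x).
Qed.

(** * Counting in blocks of consecutive indices *)

Section Blocks.
Variables (N K m M : nat) (T : pred nat).
Hypothesis K_gt0 : (0 < K)%N.
Hypothesis T_shift : forall r : {ffun 'I_m -> 'I_K}, injective r ->
  (#|[set j : 'I_(N %/ K).+1 | [forall i, T (j * K + r i)%N]]| <= M)%N.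

(** A block with fewer than m hits costs at most m. A richer one costs at most K and contains some
    injective pattern of m offsets; there are at most K^m patterns, each occurring in at most M
    blocks. *)
Lemma blocks_bound :
  (\sum_(n < N.+1) T n <= m * (N %/ K).+1 + K ^ m.+1 * M)%N.
Proof.
pose R j := [set r : 'I_K | T (j * K + r)%N].
have split_blocks : (\sum_(n < N.+1) T n <= \sum_(j < (N %/ K).+1) #|R j|)%N.
  apply: (@leq_trans (\sum_(0 <= n < (N %/ K).+1 * K) T n)).
    rewrite (big_cat_nat (n := N.+1)) ?ltn_ceil //=.
    by rewrite big_mkord leq_addr.
  rewrite big_nat_mul big_mkord; apply: leq_sum => j _.
  rewrite -{1}[(j * K)%N]add0n big_addn -mulnBl subSnn mul1n big_mkord.
  by rewrite card_set_sum; apply: leq_sum => r _; rewrite addnC.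
have full_block j : (m <= #|R j|)%N ->
    (1 <= \sum_(r : {ffun 'I_m -> 'I_K} | injectiveb r) [forall i,
      T (j * K + r i)])%N.
  move=> mR; pose r : {ffun 'I_m -> 'I_K} := [ffun i =>
    enum_val (widen_ord mR i)].
  have rinj : injectiveb r.
    apply/injectiveP => i i'; rewrite !ffunE =>
      /enum_val_inj /(congr1 val) /= ii.
    exact: val_inj.
  rewrite (bigD1 r) //=; apply: leq_trans (leq_addr _ _).
  suff -> : [forall i, T (j * K + r i)%N] by [].
  by apply/forallP => i; rewrite ffunE; have := enum_valP (widen_ord mR i);
    rewrite inE.
have block j : (#|R j| <= m + K * \sum_(r : {ffun 'I_m ->
  'I_K} | injectiveb r) [forall i, T (j * K + r i)])%N.
  have [/full_block le|/ltnW le] := leqP m #|R j|;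
    last exact: leq_trans le (leq_addr _ _).
  apply: leq_trans (max_card _) _; rewrite card_ord;
    apply: leq_trans (leq_addl _ _).
  by rewrite leq_pmulr.
apply: leq_trans split_blocks _.
apply: leq_trans (leq_sum (index_enum _) (fun (j : 'I_(N %/ K).+1) _ =>
  block j)) _.
rewrite big_split /= sum_nat_const card_ord [(_ * m)%N]mulnC leq_add2l
  -big_distrr /= expnS -mulnA leq_mul2l.
apply/orP; right; rewrite exchange_big /=.
apply: (@leq_trans (\sum_(r : {ffun 'I_m -> 'I_K} | injectiveb r) M)).
  by apply: leq_sum => r /injectiveP /T_shift; rewrite card_set_sum.
rewrite sum_nat_cond_const leq_mul2r -[(K ^ m)%N](_ : #|{ffun 'I_m ->
  'I_K}| = _) ?max_card ?orbT //.
by rewrite card_ffun !card_ord.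
Qed.
End Blocks.

Section OrbitSubgroup.
Variables (p : nat) (f : {poly 'F_p}) (u : 'F_p) (N : nat) (G : {group {unit
  'F_p}}).
Variables (d K m B D : nat).
Local Notation t := #|G|.
Hypothesis p_pr : prime p.
Hypothesis size_f : size f = d.+1.
Hypothesis d_gt0 : (0 < d)%N.
Hypothesis orbit_inj : forall i j, (i < j <= N)%N -> seqF f u i != seqF f u j.
Hypothesis zero_orbit : forall k, (0 < k < K)%N -> seqF f 0 k != 0.
Hypothesis K_gt0 : (0 < K)%N.
Hypothesis D_ge : (d ^ K <= D)%N.
Hypothesis m_gt0 : (0 < m)%N.
Hypothesis B_gt2 : (2 < B)%N.
Hypothesis small : (2 * (m * (D * (t * B))) <= p)%N.
Hypothesis large : (4 * (m * D) * B ^ (2 * m) <= t)%N.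

(** For fixed offsets [r], the starting points u_(jK) of the blocks hit at all offsets are distinct,
    and the iterates f^(r_i) send them into the subgroup, so [stepanov_bound] counts them. *)
Lemma orbit_subgroup_bound :
  (#|orbit_set f u N :&: subgroup_set G| <=
   m * (N %/ K).+1 + K ^ m.+1 * (m * D + m * (D * (t * B)) %/ B ^ m.-1))%N.
Proof.
(* The last block may run past [N]; the first conjunct discards its tail. *)
pose T n := (n <= N)%N && (seqF f u n \in subgroup_set G).
apply: (@leq_trans (\sum_(n < N.+1) T n)).
  apply: (@leq_trans #|[set n : 'I_N.+1 | T n]|).
    apply: leq_trans (leq_imset_card (fun n : 'I_N.+1 =>
      seqF f u n) [set n : 'I_N.+1 | T n]).
    apply/subset_leq_card/fintype.subsetP => x;
      rewrite inE => /andP[/imsetP[n _ ->] nG].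
    by apply: imset_f; rewrite inE /T nG -ltnS ltn_ord.
  by rewrite card_set_sum.
apply: blocks_bound => // r r_inj.
set J := [set j | _].
pose s := [seq seqF f u (j * K) | j : 'I_(N %/ K).+1 in J].
have JT (j : 'I_(N %/ K).+1) i : j \in J -> T (j * K + r i)%N.
  by rewrite inE => /forallP.
have JN (j : 'I_(N %/ K).+1) : j \in J -> (j * K <= N)%N.
  move/(JT j (Ordinal m_gt0)) => /andP[jN _];
    exact: leq_trans (leq_addr _ _) jN.
have us : uniq s.
  rewrite map_inj_in_uniq ?enum_uniq // => j1 j2;
    rewrite !mem_enum => /JN j1N /JN j2N eqj.
  apply: val_inj => /=; apply/eqP; rewrite -(eqn_pmul2r K_gt0).
  have [lt|lt|//] := ltngtP (j1 * K)%N (j2 * K)%N.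
    by have := orbit_inj (_ : j1 * K < j2 * K <= N)%N;
      rewrite lt j2N eqj eqxx => /(_ isT).
  by have := orbit_inj (_ : j2 * K < j1 * K <= N)%N;
    rewrite lt j1N eqj eqxx => /(_ isT).
rewrite -(size_image (fun j : 'I_(N %/ K).+1 => seqF f u (j * K)) J) -/s.
have B0 : (0 < B ^ m.-1)%N by rewrite expn_gt0; case: (B) B_gt2.
have := @stepanov_bound 'F_p p (pchar_Fp p_pr) m B D t (fun i =>
  iter_poly f (r i)) m_gt0 B_gt2 _ _ small large s us _.
rewrite -leq_divRL // divnDl; last by rewrite dvdn_mulr.
rewrite mulKn //; apply.
- move=> i j ij; wlog lt : i j ij / (r i < r j)%N => [wl|].
    have [lt|lt|/val_inj/r_inj eq_ij] := ltngtP (r i) (r j); first exact: wl.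
      by rewrite coprimep_sym; apply: wl; rewrite // eq_sym.
    by rewrite eq_ij eqxx in ij.
  rewrite -(subnK (ltnW lt)); apply: coprimep_iter_poly.
  by apply: zero_orbit; rewrite subn_gt0 lt; apply: leq_ltn_trans (leq_subr _
    _) (ltn_ord _).
- move=> i; rewrite (size_iter_poly _ size_f d_gt0) ltnS expn_gt0 d_gt0 /= ltnS.
  by apply: leq_trans D_ge; rewrite leq_pexp2l // ltnW.
- move=> x /mapP[j]; rewrite mem_enum => jJ -> i;
  rewrite horner_iter_poly -seqFD addnC.
  have /andP[_ /imsetP[g gG ->]] := JT _ i jJ.
  have /eqP gt1 : (g ^+ t)%g == 1%g by rewrite -order_dvdn order_dvdG.
  by rewrite -FinRing.val_unitX gt1.
Qed.
End OrbitSubgroup.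

(** * Choice of parameters *)

Section RealBounds.
Variable R : realType.
Implicit Types (x y z eps : R).

Lemma ler_exp_inv n x y : (0 < n)%N -> 0 <= x -> 0 <= y -> x ^+ n <= y ^+ n ->
  x <= y.
Proof. by move=> n0 x0 y0; rewrite ler_pXn2r. Qed.

(** [B] is the integer part of the 2m-th root y of z. Since 9^m = 3^(2m), y is at least 3, whence y
    < B + 1 <= 2 B. *)
Lemma floor_root m z : (0 < m)%N -> 9 ^+ m <= z ->
  exists B : nat, [/\ (2 < B)%N, B%:R ^+ (2 * m) <= z &
    z <= (2 * B%:R) ^+ (2 * m)].
Proof.
move=> m0 mz; have z0 : 0 <= z by apply: le_trans mz; rewrite exprn_ge0.
have m20 : (0 < 2 * m)%N by rewrite muln_gt0.
pose y := z `^ (2 * m)%:R^-1; have y0 : 0 <= y by exact: powR_ge0.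
have yE : y ^+ (2 * m) = z.
  by rewrite -powR_mulrn // -powRrM mulVf ?powRr1 // pnatr_eq0 -lt0n.
have y3 : 3 <= y.
  by apply: (ler_exp_inv m20) => //; rewrite yE exprM expr2;
    apply: le_trans mz; rewrite lerXn2r // ?nnegrE; lra.
have /andP[By yB] := truncn_itv y0.
have B3 : (2 < Num.truncn y)%N by rewrite truncn_ge_nat.
exists (Num.truncn y); split=> //; rewrite -yE lerXn2r ?nnegrE ?mulr_ge0 ?ler0n
  //.
apply: le_trans (ltW yB) _; rewrite -natr1.
have : 3 <= (Num.truncn y)%:R :> R by rewrite ler_nat.
lra.
Qed.

(** Apply 1 + s <= exp s to s = (y / k) ln x and raise to the power k. *)
Lemma ln_exp_le_powR x y k : 0 < y -> 1 <= x -> (0 < k)%N ->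
  ln x ^+ k <= (k%:R / y) ^+ k * x `^ y.
Proof.
move=> y0 x1 k0; have x0 : 0 < x by lra.
have kR0 : 0 < k%:R :> R by rewrite ltr0n.
have lnx0 : 0 <= ln x by exact: ln_ge0.
have -> : x `^ y = (x `^ (y / k%:R)) ^+ k.
  by rewrite -powR_mulrn ?powR_ge0 // -powRrM divfK // gt_eqF.
have ky0 : 0 < k%:R / y by exact: divr_gt0.
rewrite -exprMn; apply: lerXn2r; rewrite ?nnegrE //.
  exact: mulr_ge0 (ltW ky0) (powR_ge0 _ _).
rewrite -ler_pdivrMl // invf_div.
have e0 := expR_ge1Dx (y / k%:R * ln x).
rewrite /powR gt_eqF //; lra.
Qed.

Lemma natr_div_le a b : (0 < b)%N -> (a %/ b)%:R <= a%:R / b%:R :> R.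
Proof. by move=> b0; rewrite ler_pdivlMr ?ltr0n //
  -natrM ler_nat leq_trunc_div. Qed.

(* Both sides are squared, since [B ^ m] is comparable to the square root of
   [T / (4 m D)] only. *)
Lemma stepanov_quotient_le m (X n D T B : R) : (0 < m)%N ->
  1 <= X -> 0 < D -> D <= X -> 0 < B -> B <= X -> 0 <= T -> 0 <= n ->
  T * X ^+ 16 <= n ^+ 2 -> T <= 4 * (m%:R * D) * (2 * B) ^+ (2 * m) ->
  m%:R * (D * (T * B)) / B ^+ m.-1 <= 2 * m%:R ^+ 2 * 2 ^+ m * n / X ^+ 4.
Proof.
move=> m0 X1 D0 DX B0 BX T0 n0 TX TB.
have m1 : 1 <= m%:R :> R by rewrite ler1n.
have X0 : 0 < X by lra.
have -> : B ^+ m.-1 = B ^+ m / B.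
  by rewrite -[in B ^+ m](prednK m0) exprSr mulfK // gt_eqF.
have Bm0 : 0 < B ^+ m by rewrite exprn_gt0.
have twom0 : 0 < 2 ^+ m :> R by rewrite exprn_gt0.
suff le : D * T * B ^+ 2 * X ^+ 4 <= 2 * m%:R * 2 ^+ m * n * B ^+ m.
  rewrite invf_div ler_pdivlMr ?exprn_gt0 // mulrA mulrAC -!mulrA mulrCA !mulrA.
  rewrite ler_pdivrMr //.
  rewrite [X in X <= _](_ : _ = m%:R * (D * T * B ^+ 2 * X ^+ 4)); last by ring.
  rewrite [X in _ <= X](_ : _ = m%:R * (2 * m%:R * 2 ^+ m * n * B ^+ m));
    last by ring.
  by rewrite ler_wpM2l // ltW // (lt_le_trans ltr01).
have [D0' B0' X0' Bm0'] : [/\ 0 <= D, 0 <= B, 0 <= X & 0 <= B ^+ m] by split;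
  exact: ltW.
have [m0' twom0'] : 0 <= m%:R :> R /\ 0 <= 2 ^+ m :> R by split; lra.
apply: (@ler_exp_inv 2) => //.
- by rewrite !mulr_ge0 ?exprn_ge0.
- by rewrite !mulr_ge0 ?exprn_ge0.
(* The squared left side contains T twice: one factor is bounded by [TB'], which adds a third D; the
   other meets at most X^15, and T X^15 <= n^2. *)
have Ble : D ^+ 3 * B ^+ 4 * X ^+ 8 <= X ^+ 15.
  rewrite (_ : X ^+ 15 = X ^+ 3 * X ^+ 4 * X ^+ 8); last by rewrite -!exprD.
  by rewrite ler_wpM2r ?exprn_ge0 // ler_pM ?exprn_ge0 // lerXn2r.
have TX15 : T * X ^+ 15 <= n ^+ 2.
  by apply: le_trans TX; rewrite ler_wpM2l // ler_weXn2l.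
pose S := 2 ^+ m * B ^+ m; have S0 : 0 < S by rewrite mulr_gt0.
have TB' : T <= 4 * (m%:R * D) * S ^+ 2.
  by move: TB; rewrite mulnC exprM exprMn.
have S20 : 0 <= S ^+ 2 by rewrite exprn_ge0 // ltW.
have E0 : 0 <= D ^+ 3 * B ^+ 4 * X ^+ 8.
  by rewrite !mulr_ge0 ?exprn_ge0.
rewrite [leLHS](_ : _ = T * (T * (D ^+ 2 * B ^+ 4 * X ^+ 8))); last by ring.
rewrite [leRHS](_ : _ = 4 * m%:R * S ^+ 2 * (m%:R * n ^+ 2));
  last by rewrite /S; ring.
apply: (@le_trans _ _ (4 * m%:R * S ^+ 2 * (T * X ^+ 15))); last first.
  rewrite ler_wpM2l //; first by rewrite !mulr_ge0.
  by apply: le_trans TX15 _; rewrite ler_peMl // exprn_ge0.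
apply: (@le_trans _ _ (4 * (m%:R * D) * S ^+ 2 * (T * (D ^+ 2 * B ^+ 4 * X ^+
  8)))).
  by apply: ler_wpM2r TB'; rewrite !mulr_ge0 ?exprn_ge0.
rewrite [leLHS](_ : _ = 4 * m%:R * S ^+ 2 * (T * (D ^+ 3 * B ^+ 4 * X ^+ 8)));
  last by ring.
apply: ler_wpM2l; first by rewrite !mulr_ge0.
by rewrite ler_wpM2l.
Qed.

(** Everything is measured by X = N^(eps/16): both d^K and B are at most X, and X also dominates any
    power of ln N up to a constant. *)
Lemma choose_parameters eps (d : nat) : 0 < eps -> eps < 1 -> (1 < d)%N ->
  exists m : nat, (0 < m)%N /\ exists c : R, 0 < c /\
  forall N p t : nat, (1 < N)%N -> (N <= p)%N ->
    N%:R `^ eps < t%:R :> R -> t%:R < N%:R `^ (2 - eps) :> R ->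
    t%:R < p%:R `^ (1 - eps) :> R -> c <= ln N%:R ->
  exists K B : nat, [/\ (0 < K)%N, (d ^ K <= N)%N, (2 < B)%N,
    (2 * (m * (d ^ K * (t * B))) <= p)%N &
    (4 * (m * d ^ K) * B ^ (2 * m) <= t)%N] /\
    (m * (N %/ K).+1 + K ^ m.+1 *
       (m * d ^ K + m * (d ^ K * (t * B)) %/ B ^ m.-1))%:R * ln N%:R <= c *
         N%:R.
Proof.
move=> eps0 eps1 d1.
(* With this m, X^(2m) >= N^2 >= t, which yields B <= X. *)
have [m m0 meps] : exists2 m : nat, (0 < m)%N & 16 <= eps * m%:R.
  exists (Num.truncn (16 / eps)).+1 => //.
  by rewrite mulrC -ler_pdivrMr // ltW // truncnS_gt.
exists m; split=> //.
have lnd0 : 0 < ln d%:R :> R by rewrite ln_gt0 // ltr1n.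
(* Chosen so that d^(kap ln N) = X. *)
pose kap : R := eps / 16 / ln d%:R; have kap0 : 0 < kap by rewrite !divr_gt0.
have m1 : 1 <= m%:R :> R by rewrite ler1n.
(* X >= X0 gives t >= X^2 >= 4 m D 9^m, as [floor_root] requires. *)
pose X0 : R := 4 * m%:R * 9 ^+ m.
have nine : 1 <= 9 ^+ m :> R by rewrite exprn_ege1 // ler1n.
have X01 : 1 <= X0 by rewrite /X0; nra.
pose C1 : R := (m.+2%:R / (eps / 16)) ^+ m.+2.
pose C2 : R := m%:R + 2 * m%:R ^+ 2 * 2 ^+ m.
have e16 : 0 < eps / 16 by rewrite divr_gt0.
have C20 : 0 <= C2 by rewrite /C2 addr_ge0 ?mulr_ge0 ?exprn_ge0 ?ler0n.
have C10 : 0 <= C1 by rewrite /C1 exprn_ge0 // divr_ge0 // ltW.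
pose C3 : R := kap ^+ m.+1 * C2 * C1.
pose l0 : R := 16 / eps * ln X0.
(* [l0] forces X >= X0 and [2 / kap] forces kap ln N >= 2; the last two summands are the constants
   of [first_part] and [second_part]. *)
pose c : R := l0 + 2 / kap + m%:R * (2 / kap + 1) + C3.
have c0 : [/\ 0 <= l0, 0 < 2 / kap & 0 <= C3].
  split; first by rewrite mulr_ge0 ?ln_ge0 // ltW // divr_gt0.
    by rewrite divr_gt0.
  exact: mulr_ge0 (mulr_ge0 (exprn_ge0 _ (ltW kap0)) C20) C10.
case: c0 => l00 kap20 C30.
exists c; split.
  by have := mulr_gt0 (lt_le_trans ltr01 m1) (addr_gt0 kap20 ltr01);
    rewrite /c; lra.
move=> N p t N1 Np tlo thi tp cN.
have mkap0 : 0 < m%:R * (2 / kap + 1) by rewrite mulr_gt0; lra.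
have lN : l0 <= ln N%:R by move: cN; rewrite /c; lra.
have kN : 2 <= kap * ln N%:R.
  by rewrite mulrC -ler_pdivrMr //; move: cN; rewrite /c; lra.
set n : R := N%:R in tlo thi cN lN kN *; set T : R := t%:R in tlo thi tp *.
set P : R := p%:R in tp *.
have n1 : 1 < n by rewrite ltr1n.
have n0 : 0 < n by lra.
have nP : n <= P by rewrite ler_nat.
have P1 : 1 <= P by lra.
have lnn0 : 0 < ln n by exact: ln_gt0.
pose X : R := n `^ (eps / 16); pose Q : R := P `^ (eps / 16).
have XE : X = expR (eps / 16 * ln n) by rewrite /X /powR gt_eqF.
have XX0 : X0 <= X.
  rewrite XE -[X0]lnK ?posrE; last by lra.
  by rewrite ler_expR -ler_pdivrMl // invf_div.
have X1 : 1 <= X by lra.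
have X_gt0 : 0 < X by lra.
have X16 : X ^+ 16 = n `^ eps.
  by rewrite -powR_mulrn ?powR_ge0 // -powRrM divfK.
have X16n : X ^+ 16 <= n.
  by rewrite X16 -[leRHS]powRr1 ?(ltW n0) // ler_powR ?ltW.
have TX : T * X ^+ 16 <= n ^+ 2.
  have -> : n ^+ 2 = n `^ (2 - eps) * n `^ eps.
    by rewrite -powRD ?subrK ?powR_mulrn ?(ltW n0) // gt_eqF ?implybT.
  by rewrite X16 ler_wpM2r ?powR_ge0 // ltW.
have QQ : 1 <= Q by rewrite -(powRr0 P) ler_powR // ltW.
have Q16 : T * Q ^+ 16 <= P.
  rewrite -[Q ^+ 16]powR_mulrn ?powR_ge0 // -powRrM divfK //.
  apply: (@le_trans _ _ (P `^ (1 - eps) * P `^ eps)).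
    by rewrite ler_wpM2r ?powR_ge0 // ltW.
  by rewrite -powRD ?subrK ?powRr1 ?gt_eqF ?implybT //; lra.
have XQ : X <= Q by apply: ge0_ler_powR; rewrite ?nnegrE // ltW //; lra.
pose K := Num.truncn (kap * ln n); pose D := (d ^ K)%N.
have kn0 : 0 <= kap * ln n by lra.
have /andP[Kle Kgt] := truncn_itv kn0; rewrite -/K in Kle Kgt.
have K0 : (0 < K)%N by rewrite truncn_gt0; lra.
have DX : D%:R <= X.
  have dR : 1 <= d%:R :> R by rewrite ler1n ltnW.
  rewrite /D natrX -powR_mulrn //.
  apply: (@le_trans _ _ (d%:R `^ (kap * ln n))); first exact: ler_powR.
  have dn0 : (d%:R : R) != 0 by rewrite pnatr_eq0 -lt0n ltnW.
  by rewrite XE /powR (negPf dn0) ler_expR /kap mulrAC divfK // gt_eqF.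
have D0 : 0 < D%:R :> R by rewrite ltr0n expn_gt0 (ltnW d1).
have mD0 : 0 < 4 * (m%:R * D%:R) :> R by rewrite !mulr_gt0 //; lra.
have [|B [B2 Blo Bhi]] := @floor_root m (T / (4 * (m%:R * D%:R))) m0.
  rewrite ler_pdivlMr //.
  apply: (@le_trans _ _ (X * X)).
    rewrite [leLHS](_ : _ = (D%:R : R) * X0); last by rewrite /X0; ring.
    by apply: ler_pM => //; lra.
  apply: ltW; apply: le_lt_trans tlo; rewrite -X16 -expr2.
  by rewrite ler_weXn2l.
have B0 : 0 < B%:R :> R by rewrite ltr0n (ltn_trans _ B2).
have T0 : 0 <= T by exact: ler0n.
have large : 4 * (m%:R * D%:R) * B%:R ^+ (2 * m) <= T.
  by rewrite mulrC -ler_pdivlMr.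
have Bm_T : B%:R ^+ (2 * m) <= T.
  apply: le_trans large; rewrite ler_peMl ?exprn_ge0 ?(ltW B0) //.
  have : 1 <= D%:R :> R by rewrite ler1n expn_gt0 (ltnW d1).
  move: m1; clear => m1 D1.
  by rewrite -[1]mulr1 ler_pM //; [lra | nra].
have m2 : (0 < 2 * m)%N by rewrite muln_gt0.
have expX (a : R) : 1 <= a -> a ^+ 2 <= (a `^ (eps / 16)) ^+ (2 * m).
  move=> a1; rewrite -[leRHS]powR_mulrn ?powR_ge0 //
    -powRrM -[leLHS]powR_mulrn ?(le_trans ler01) //.
  by apply: ler_powR => //; rewrite natrM; move: meps; clear; lra.
have BX : B%:R <= X.
  apply: (ler_exp_inv m2); rewrite ?(ltW B0) ?(ltW X_gt0) //.
  apply: le_trans Bm_T _; apply: le_trans (expX n (ltW n1)).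
  by apply: le_trans TX; rewrite ler_peMr // exprn_ege1.
have BQ : B%:R <= Q by exact: le_trans XQ.
have DQ : D%:R <= Q by exact: le_trans XQ.
exists K, B; split; first split=> //.
- rewrite -(ler_nat R) -/n; apply: le_trans DX _; apply: le_trans X16n.
  by rewrite -[leLHS]expr1 ler_weXn2l.
- rewrite -(ler_nat R) !natrM -/D -/T -/P.
  have mQ : 2 * m%:R <= Q.
    apply: le_trans XQ; apply: le_trans XX0; rewrite /X0.
    by move: m1 nine; clear; nra.
  apply: le_trans Q16; rewrite mulrA.
  (* Each of 2m, D and B is at most Q, and T Q^3 <= T Q^16 <= p. *)
  apply: (@le_trans _ _ (Q * (Q * (T * Q)))).
    by do !apply: ler_pM; rewrite ?mulr_ge0 //; lra.
  rewrite (_ : Q * _ = T * Q ^+ 3); last by ring.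
  by rewrite ler_wpM2l // ler_weXn2l.
- by rewrite -(ler_nat R) !natrM -/D [(B ^ _)%:R]natrX.
have Bhi' : T <= 4 * (m%:R * D%:R) * (2 * B%:R) ^+ (2 * m).
  by rewrite mulrC -ler_pdivrMr.
have quot := stepanov_quotient_le m0 X1 D0 DX B0 BX T0 (ltW n0) TX Bhi'.
rewrite natrD mulrDl.
have first_part : (m * (N %/ K).+1)%:R * ln n <= m%:R * (2 / kap + 1) * n.
  have lnn : ln n <= n by apply: ltW; exact: ln_sublinear.
  rewrite natrM -!mulrA; apply: ler_wpM2l; first by rewrite ler0n.
  rewrite -natr1 mulrDl mul1r mulrDl mul1r lerD //.
  apply: (@le_trans _ _ (n / K%:R * ln n)).
    by rewrite ler_wpM2r ?(ltW lnn0) // natr_div_le.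
  (* K > kap ln n - 1 >= kap ln n / 2, because kap ln n >= 2. *)
  have lnK : ln n <= 2 / kap * K%:R.
    rewrite mulrAC ler_pdivlMr //; move: Kgt; rewrite -natr1.
    by move: kN; clear; lra.
  rewrite mulrAC ler_pdivrMr ?ltr0n // -mulrA mulrCA.
  by rewrite [leRHS](_ : _ = n * (2 / kap * K%:R)) ?(ler_pM2l n0) //; ring.
have second_part : (K ^ m.+1 * (m * D + m * (D * (t * B)) %/ B ^ m.-1))%:R * ln
  n <= C3 * n.
  have Bm0 : (0 < B ^ m.-1)%N by rewrite expn_gt0 (ltn_trans _ B2).
  have inner : (m * D + m * (D * (t * B)) %/ B ^ m.-1)%:R <= C2 * n / X ^+ 4.
    have X4 : 0 < X ^+ 4 by rewrite exprn_gt0.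
    rewrite natrD natrM /C2 [(_ + _) * n]mulrDl [leRHS]mulrDl lerD //.
      apply: (@le_trans _ _ (m%:R * X)); first by rewrite ler_wpM2l.
      rewrite -mulrA ler_wpM2l //.
      rewrite ler_pdivlMr // -exprS; apply: le_trans X16n.
      by rewrite ler_weXn2l.
    apply: le_trans (natr_div_le _ Bm0) _.
    by rewrite !natrM [(B ^ _)%:R]natrX; exact: quot.
  (* The m + 2 logarithms are m + 1 from the power of K and the one from the claim; the saving X^4
     absorbs them. *)
  have lnC : ln n ^+ m.+2 <= C1 * X by apply: ln_exp_le_powR => //; lra.
  have Kp : K%:R ^+ m.+1 <= (kap * ln n) ^+ m.+1 by rewrite lerXn2r ?nnegrE.
  rewrite natrM natrX.
  apply: (@le_trans _ _ ((kap * ln n) ^+ m.+1 * (C2 * n / X ^+ 4) * ln n)).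
    by rewrite ler_wpM2r ?(ltW lnn0) // ler_pM ?exprn_ge0.
  rewrite (_ : _ * ln n = kap ^+ m.+1 * C2 * n / X ^+ 4 * ln n ^+ m.+2);
    last first.
    by rewrite exprMn [ln n ^+ m.+2]exprSr; ring.
  apply: (@le_trans _ _ (kap ^+ m.+1 * C2 * n / X ^+ 4 * (C1 * X))).
    by rewrite ler_wpM2l // !mulr_ge0 ?exprn_ge0 ?invr_ge0 ?exprn_ge0 // ltW.
  rewrite (_ : _ * (C1 * X) = C3 * n * (X / X ^+ 4)); last by rewrite /C3; ring.
  apply: ler_piMr; first exact: mulr_ge0 C30 (ltW n0).
  rewrite ler_pdivrMr ?exprn_gt0 // mul1r.
  by rewrite -[leLHS]expr1 ler_weXn2l.
apply: le_trans (lerD first_part second_part) _.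
rewrite -mulrDl ler_wpM2r ?(ltW n0) // /c; lra.
Qed.

End RealBounds.

(** * Trajectories, the period of zero and the theorem *)

Section Trajectory.
Variables (F : finFieldType) (f : {poly F}).

Lemma seqF_neq u N i j : (N < trajectory_length f u)%N -> (i < j <= N)%N ->
  seqF f u i != seqF f u j.
Proof.
rewrite /trajectory_length; case: ex_minnP => t _ tmin Nt /andP[ij jN].
apply: contraTneq Nt => eq_ij; rewrite -leqNgt; apply: leq_trans jN;
  apply: tmin.
by apply/existsP; exists (Ordinal ij); rewrite eq_ij.
Qed.

Lemma card_orbit_set u N : (N < trajectory_length f u)%N ->
  #|orbit_set f u N| = N.+1.
Proof.
move=> Nt; rewrite card_imset ?card_ord // => i j eq_ij; apply: val_inj.
have [lt|lt|//] := ltngtP (i : nat) j.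
  by have := @seqF_neq u N i j Nt; rewrite lt -ltnS ltn_ord eq_ij eqxx =>
    /(_ isT).
by have := @seqF_neq u N j i Nt; rewrite lt -ltnS ltn_ord eq_ij eqxx =>
  /(_ isT).
Qed.

Lemma period_length_le k : (0 < k)%N -> seqF f 0 k = 0 ->
  exists2 P, period_length f 0 = Some P & (P <= k)%N.
Proof.
move=> k0 fk; have per : `[< is_period f 0 k >].
  by apply/asboolP; split=> // n; rewrite seqFD fk.
rewrite /period_length; case: pselect => [ex|[]]; last by exists k.
by exists (ex_minn ex) => //; case: ex_minnP => P _; apply.
Qed.
End Trajectory.

Theorem corollary1p4 (R : realType) (eps : R) (d : nat) :
  0 < eps -> (2 <= d)%N ->
  exists c1 c2 : R, 0 < c1 /\ 0 < c2 /\
    forall p : nat, prime p ->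
    forall (f : {poly 'F_p}) (u : 'F_p) (N : nat) (G : {group {unit 'F_p}}),
      size f = d.+1 ->
      N%:R `^ eps < #|G|%:R ->
      #|G|%:R < Num.min (N%:R `^ (2 - eps)) (p%:R `^ (1 - eps)) ->
      (2 <= N)%N ->
      (N%:R%:E < Order.min (pow_period d c1 (period_length f 0%R))
                           (trajectory_length f u)%:R%:E)%E ->
      rho R f u G N < c2 * (1 / ln N%:R).
Proof.
(* For eps >= 1 the conditions on the order of the group contradict each other, since 2 - eps <=
   eps. *)
move=> eps0 d2; have [eps1|eps1] := ltP eps 1; last first.
  exists 1, 1; do 2!split=> //; move=> p _ f u N G _ tlo.
  rewrite lt_min => /andP[thi _] N2 _.
  have := lt_trans tlo thi; rewrite ltNge ler_powR ?ler1n ?(ltnW N2) //; lra.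
have [m [m0 [c [c0 choose]]]] := choose_parameters eps0 eps1 d2.
exists 1, (c + 1); split=> //; split; first by lra.
move=> p p_pr f u N G sf tlo; rewrite lt_min => /andP[thi tp] N2.
rewrite lt_min lte_fin ltr_nat => /andP[Nper Ntraj].
have n0 : 0 < N%:R :> R by rewrite ltr0n ltnW.
have lnN0 : 0 < ln N%:R :> R by rewrite ln_gt0 // ltr1n.
have Np : (N <= p)%N.
  by apply: ltnW; rewrite -(card_orbit_set Ntraj) -[leqRHS](card_Fp p_pr)
    max_card.
rewrite /rho (card_orbit_set Ntraj) mul1r ltr_pdivrMr ?ltr0n //.
rewrite mulrAC ltr_pdivlMr //.
(* For small N the trivial bound rho <= 1 suffices; this is why c2 exceeds c. *)
have [lnc|clN] := ltP (ln N%:R) c.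
  have : #|orbit_set f u N :&: subgroup_set G|%:R <= N.+1%:R :> R.
    by rewrite ler_nat -(card_orbit_set Ntraj) subset_leq_card ?subsetIl.
  have : 0 < N.+1%:R :> R by rewrite ltr0n.
  nra.
have [K [B [[K0 dKN B2 small large] bound]]] :=
  choose N p #|G| N2 Np tlo thi tp clN.
(* A return to 0 at time k < K would give a period P <= k, so d^P <= d^K <= N, against the
   hypothesis on N with c1 = 1. *)
have zero k : (0 < k < K)%N -> seqF f 0 k != 0.
  case/andP=> k0 kK; apply: contraTneq Nper => /(period_length_le k0)[P -> Pk].
  rewrite -leNgt lee_fin mul1r powR_mulrn // -natrX ler_nat.
  by apply: leq_trans dKN; rewrite leq_pexp2l ?(ltnW d2) // (leq_trans Pk) //
    ltnW.
have := @orbit_subgroup_bound p f u N G d K m B (d ^ K) p_pr sf (ltnW d2)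
  (fun i j => seqF_neq Ntraj) zero K0 (leqnn _) m0 B2 small large.
rewrite -(ler_nat R) => /(ler_wpM2r (ltW lnN0)) /le_trans /(_ bound).
by move=> le; apply: le_lt_trans le _; rewrite -natr1; lra.
Qed.
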